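(* Let $m$ be a positive integer, let $f\in\mathbb{R}[z]$ be an approximate radix-$m$ kernel with error map $E(z) = 1-(1-z)f(z)$, let $A\in\mathbb{R}^{d\times d}$ have spectral radius $\rho(A)<1$, and put $M = I - A$. Define sequences of matrices by $Y_0 = I$, $R_0 = A$ and, for $n\ge 0$, $$Y_{n+1} = Y_n\cdot f(R_n),\qquad R_{n+1} = I - M\,Y_{n+1}.$$ Then for every $n\ge 0$: 1. $R_n = E^{[n]}(A)$; 2. $R_n = O(A^{m^n})$; 3. $Y_n = \sum_{j=0}^{m^n-1} A^j + O(A^{m^n})$.
   Context: A polynomial $f\in\mathbb{R}[z]$ is an approximate radix-$m$ kernel if $(1-z)f(z) = 1 + O(z^m)$, i.e. $z^m$ divides $(1-z)f(z)-1$ in $\mathbb{R}[z]$. The $n$-fold composition of $E$ is denoted $E^{[n]}$: $E^{[0]}(z)=z$ and $E^{[n+1]} = E\circ E^{[n]}$. The notation $O(A^{k})$ is formal: it stands for a matrix of the form $A^{k}q(A)$ where $q\in\mathbb{R}[z]$ is a polynomial depending only on $f$ and $n$ (not on $A$ or $d$). *)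

(* Defs.v *)
From mathcomp Require Import all_boot all_order all_algebra.
From mathcomp Require Import all_classical all_reals.
From mathcomp Require Import complex.

Set Implicit Arguments.
Unset Strict Implicit.
Unset Printing Implicit Defensive.

Import Order.TTheory GRing.Theory Num.Theory.
Local Open Scope classical_set_scope.
Local Open Scope ring_scope.

(* The eigenvalues of a real matrix are taken in the complex field R[i]; for
   size d.+1 they form a nonempty finite set, so that the sup is a maximum. *)
Definition spectral_radius (R : realType) (d : nat) (A : 'M[R]_d) : R :=
  sup [set Normc.normc l | l in
        [set l : R[i] | eigenvalue (map_mx (real_complex R) A) l]].

Definition approx_kernel (R : realType) (m : nat) (f : {poly R}) : Prop :=
  'X^m %| (1 - 'X) * f - 1.

Definition error_map (R : realType) (f : {poly R}) : {poly R} :=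
  1 - (1 - 'X) * f.

(* E \Po p is the composition z |-> E (p z). *)
Fixpoint iter_comp (R : realType) (E : {poly R}) (n : nat) : {poly R} :=
  if n is k.+1 then E \Po iter_comp E k else 'X.

Fixpoint kernel_iter (R : realType) (f : {poly R}) (d : nat)
    (A : 'M[R]_d.+1) (n : nat) : 'M[R]_d.+1 * 'M[R]_d.+1 :=
  if n is k.+1 then
    let Y := (kernel_iter f A k).1 * horner_mx (kernel_iter f A k).2 f in
    (Y, 1 - (1 - A) * Y)
  else (1, A).

Definition Yseq (R : realType) (f : {poly R}) (d : nat) (A : 'M[R]_d.+1)
  (n : nat) : 'M[R]_d.+1 := (kernel_iter f A n).1.

Definition Rseq (R : realType) (f : {poly R}) (d : nat) (A : 'M[R]_d.+1)
  (n : nat) : 'M[R]_d.+1 := (kernel_iter f A n).2.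

(* Main.v *)
Require Import Defs.
From mathcomp Require Import all_boot all_order all_algebra.
From mathcomp Require Import all_classical all_reals.
From mathcomp Require Import complex.
From mathcomp Require Import ring.

(** Every matrix in the recursion is a polynomial in [A], so the statement is
    the image under evaluation at [A] of identities in [R[z]].  Write [E] for
    the error map and [r_n] for its [n]-th iterate, and let [y_n] be the product
    of the [f(r_k)] for [k < n], the polynomial that evaluates to [Y_n].  The
    definition of [E] says that [1 - E(z) = (1 - z) f(z)]; put [z := r_k] and
    multiply over [k < n]: the product telescopes to [1 - r_n = (1 - z) y_n]
    ([kernel_poly_residual]), and at [A] this says that [R_n] is [r_n(A)].

    The kernel condition makes [z^m] divide [E], so that each composition with
    [E] multiplies the order of vanishing at 0 by at least [m]
    ([dvdp_iter_error_map]).  Hence [(1 - z) y_n] is 1 modulo [z^(m^n)]; as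
    [1 - z] is invertible modulo [z^(m^n)] with the truncated geometric series
    as its inverse, [y_n] agrees with that series modulo [z^(m^n)]
    ([dvdp_sub_geometric]). *)

Set Implicit Arguments.
Unset Strict Implicit.
Unset Printing Implicit Defensive.

Import Order.TTheory GRing.Theory Num.Theory.
Local Open Scope ring_scope.

Lemma horner_mx_comp_poly (R : comNzRingType) (d : nat) (A : 'M[R]_d.+1)
    (p q : {poly R}) :
  horner_mx A (p \Po q) = horner_mx (horner_mx A q) p.
Proof.
elim/poly_ind: p => [|p c IHp]; first by rewrite comp_poly0 !rmorph0.
rewrite comp_polyD comp_polyM comp_polyX comp_polyC !rmorphD !rmorphM /= IHp.
by rewrite !horner_mx_C horner_mx_X.
Qed.

Fixpoint kernel_poly (R : realType) (f : {poly R}) (n : nat) : {poly R} :=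
  if n is k.+1 then kernel_poly f k * (f \Po iter_comp (error_map f) k) else 1.

Lemma kernel_poly_residual (R : realType) (f : {poly R}) (n : nat) :
  1 - (1 - 'X) * kernel_poly f n = iter_comp (error_map f) n.
Proof.
elim: n => [|n IHn] /=; first by ring.
rewrite /error_map comp_polyB comp_polyM comp_polyB comp_polyX !comp_polyC.
rewrite -/(error_map f) -[in X in _ = _ - (_ - X) * _]IHn; ring.
Qed.

Lemma kernel_iterE (R : realType) (f : {poly R}) (d : nat) (A : 'M[R]_d.+1)
    (n : nat) :
  kernel_iter f A n =
    (horner_mx A (kernel_poly f n), horner_mx A (iter_comp (error_map f) n)).
Proof.
elim: n => [|n IHn] /=; first by rewrite rmorph1 horner_mx_X.
rewrite IHn /= -horner_mx_comp_poly -rmorphM /=.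
rewrite -/(iter_comp _ n.+1) -(kernel_poly_residual f n.+1) /=.
by rewrite !(rmorphB, rmorphM) /= rmorph1 horner_mx_X.
Qed.

(** If [E = z^m g], then [E(p) = p^m g(p)]: one composition with [E] raises
    to the power [m] any power of [z] that divides [p]. *)
Lemma dvdp_iter_error_map (R : realType) (m : nat) (f : {poly R}) (n : nat) :
  approx_kernel m f -> 'X^(m ^ n) %| iter_comp (error_map f) n.
Proof.
move=> hf; have /dvdpP[g Eg] : 'X^m %| error_map f.
  by rewrite /error_map -opprB dvdpNr.
elim: n => [|n IHn] /=; first by rewrite expn0 expr1.
rewrite [X in X \Po _]Eg comp_polyM comp_Xn_poly dvdp_mull //.
by rewrite expnSr exprM dvdp_exp2r.
Qed.

(** Modulo [z^N], the truncated geometric series is the only inverse of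
    [1 - z]: for [S] the series, [S (1 - (1 - z) y)] is on the one hand a
    multiple of [z^N], and on the other [S - y] up to a multiple of [z^N],
    because [S (1 - z) = 1 - z^N]. *)
Lemma dvdp_sub_geometric (R : fieldType) (N : nat) (y : {poly R}) :
  'X^N %| 1 - (1 - 'X) * y -> 'X^N %| y - \sum_(0 <= j < N) 'X^j.
Proof.
set S := \sum_(0 <= j < N) _; move=> dvd_y.
have geomS : 'X^N = 1 - (1 - 'X) * S.
  by rewrite /S big_mkord -[1 - 'X]opprB mulNr opprK -subrX1 addrC subrK.
have -> : y - S = (1 - (1 - 'X) * S) * y - S * (1 - (1 - 'X) * y) by ring.
by rewrite -geomS; apply: dvdp_sub; [exact: dvdp_mulr | exact: dvdp_mull].
Qed.

Theorem lemma5p9 (R : realType) (m : nat) (f : {poly R})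
    (m_gt0 : (0 < m)%N) (hf : approx_kernel m f) (n : nat) :
  exists q r : {poly R},
  forall (d : nat) (A : 'M[R]_d.+1), spectral_radius A < 1 ->
    [/\ Rseq f A n = horner_mx A (iter_comp (error_map f) n),
        Rseq f A n = A ^+ (m ^ n) * horner_mx A q
      & Yseq f A n = \sum_(0 <= j < m ^ n) A ^+ j
                     + A ^+ (m ^ n) * horner_mx A r].
Proof.
have Rdvd := dvdp_iter_error_map n hf.
have /dvdpP[r Yr] :
    'X^(m ^ n) %| kernel_poly f n - \sum_(0 <= j < m ^ n) 'X^j.
  by apply: dvdp_sub_geometric; rewrite kernel_poly_residual.
have /dvdpP[q Rq] := Rdvd.
have hornerXn d (A : 'M[R]_d.+1) k : horner_mx A 'X^k = A ^+ k.
  by rewrite rmorphXn /= horner_mx_X.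
exists q, r => d A _; rewrite /Rseq /Yseq kernel_iterE /=; split=> //.
  by rewrite Rq mulrC rmorphM /= hornerXn.
rewrite -[kernel_poly f n](subrK (\sum_(0 <= j < m ^ n) 'X^j)) Yr addrC mulrC.
rewrite rmorphD rmorphM rmorph_sum /= hornerXn.
by congr (_ + _); apply: eq_bigr => j _; rewrite hornerXn.
Qed.
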